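(* Let $\iota(S^n)\subset\mathbb{R}^{n+1}$ be the unit hypersphere with central point $\widehat{x}_0$, and let $\widehat{x}\in\iota(S^n)$ have geodesic distance $d=d(\widehat{x},\widehat{x}_0)<\pi$. Let $\boldsymbol{u}\in T_{\widehat{x}}\iota(S^n)$ be the unit radial direction (tangent at $\widehat{x}$ to the geodesic from $\widehat{x}_0$ to $\widehat{x}$). Then for every $\boldsymbol{v}\in T_{\widehat{x}}\iota(S^n)$, $$\pi_0\,\boldsymbol{v}=\mathcal{P}_{\widehat{x}}[\boldsymbol{v}]-(1-\cos d)\,\langle\boldsymbol{v},\boldsymbol{u}\rangle\,\mathcal{P}_{\widehat{x}}[\boldsymbol{u}];$$ that is, central projection is parallel transport composed with a $\cos d$ contraction of the radial component, and transverse components (those orthogonal to $\boldsymbol{u}$) are transported exactly.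
   Context: $\iota(S^n)=\{\widehat{x}\in\mathbb{R}^{n+1}:\|\widehat{x}\|_2=1\}$, $n\ge 1$, with the Riemannian metric induced by the Euclidean inner product $\langle\cdot,\cdot\rangle$. The tangent space $T_{\widehat{x}}\iota(S^n)=\{\widehat{\boldsymbol{v}}\in\mathbb{R}^{n+1}:\widehat{x}^{\top}\widehat{\boldsymbol{v}}=0\}$ is viewed as a linear subspace of $\mathbb{R}^{n+1}$. $\pi_0=I_{n+1}-\widehat{x}_0\widehat{x}_0^{\top}$ is the orthogonal projection of $\mathbb{R}^{n+1}$ onto $T_{\widehat{x}_0}\iota(S^n)$. $\mathcal{P}_{\widehat{x}}:T_{\widehat{x}}\iota(S^n)\to T_{\widehat{x}_0}\iota(S^n)$ is Levi-Civita parallel transport along the unique minimizing geodesic from $\widehat{x}$ to $\widehat{x}_0$. If $\widehat{x}=\widehat{x}_0$ (so $d=0$), $\boldsymbol{u}$ may be taken to be any unit tangent vector. *)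

(* Defs.v *)
From HB Require Import structures.
From mathcomp Require Import all_boot all_order all_algebra.
From mathcomp Require Import all_classical all_reals all_analysis.
Import Order.TTheory GRing.Theory Num.Theory.
Import numFieldNormedType.Exports.

Set Implicit Arguments.
Unset Strict Implicit.
Unset Printing Implicit Defensive.

Local Open Scope classical_set_scope.
Local Open Scope ring_scope.

Section Sphere.
Context {R : realType} {n : nat}.
Local Notation E := 'cV[R]_n.+1.
Implicit Types (x y u v w : E) (c V : R -> E).

Definition inner u v : R := (u^T *m v) ord0 ord0.

(* The library norm on matrices is the sup norm, hence a separate 2-norm;
   both induce the same topology, so derivatives are unaffected. *)
Definition norm2 v : R := Num.sqrt (inner v v).

Definition sphere : set E := [set x | norm2 x = 1].

Definition tangent x : set E := [set v | inner x v = 0].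

Definition tproj x : 'M[R]_n.+1 := 1%:M - x *m x^T.

(* For the metric induced by the ambient Euclidean space, the Levi-Civita
   covariant derivative along c of a tangent field V is the tangential part
   of the ordinary derivative of V. *)
Definition covD c V (t : R) : E := tproj (c t) *m derive1 V t.

(* "C^1 on [a, b]" is expressed by the existence of a C^1 extension to R. *)
Definition C1_on (a b : R) c : Prop :=
  exists g : R -> E, [/\ forall t, derivable g t 1,
    continuous (derive1 g) & {in `[a, b], c =1 g}].

(* Consecutive pieces share their endpoint, so these curves are continuous
   on [0, 1]. *)
Definition piecewise_C1 c : Prop :=
  exists s : seq R, [/\ path <%R 0 s, last 0 s = 1 &
    forall i, (i < size s)%N -> C1_on (nth 0 (0 :: s) i) (nth 0 s i) c].

(* The finitely many break points, where the derivative is meaningless, are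
   negligible. *)
Definition curve_length c : R :=
  \int[lebesgue_measure]_(t in `[0, 1]) norm2 (derive1 c t).

Definition curves x y : set (R -> E) :=
  [set c | [/\ piecewise_C1 c, forall t, t \in `[0, 1] -> sphere (c t),
               c 0 = x & c 1 = y]].

Definition geodist x y : R := inf (curve_length @` curves x y).

(* The sphere being complete, geodesics are taken on the whole real line;
   segments are their restrictions to [0, 1], with affine parameter. *)
Definition geodesic c : Prop :=
  [/\ forall t, sphere (c t), forall t, derivable c t 1,
      forall t, derivable (derive1 c) t 1 & forall t, covD c (derive1 c) t = 0].

Definition min_geodesic x y c : Prop :=
  [/\ geodesic c, c 0 = x, c 1 = y & curve_length c = geodist x y].

Definition parallel c V : Prop :=
  [/\ forall t, tangent (c t) (V t), forall t, derivable V t 1 &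
      forall t, covD c V t = 0].

(* Transport of v from x to y along the minimizing geodesic, as a definite
   description: the value is determined when x and y are not antipodal and
   v is tangent at x, and is junk otherwise. *)
Definition transport x y v : E :=
  xget 0 [set w | exists c V,
    [/\ min_geodesic x y c, parallel c V, V 0 = v & V 1 = w]].

(* If x = x0 the minimizing geodesic is constant, and the last condition
   holds for every u. *)
Definition radial x0 x u : Prop :=
  [/\ tangent x u, norm2 u = 1 &
      exists2 c, min_geodesic x0 x c & derive1 c 1 = norm2 (derive1 c 1) *: u].

End Sphere.

Arguments sphere {R} n.

(* Main.v *)
(* A geodesic c solves c'' = - w^2 c with constant speed w, so it is a great
   circle, and for a parallel field V along it both k = <V, c'> and
   w^2 V - k c' are constant.  This gives parallel transport in closed form,
   without any existence or uniqueness theorem for differential equations.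

   The reversal of the minimizing geodesic that defines u is minimizing from x
   to x0 because geodist is symmetric; it has initial velocity - d u, and any
   other minimizing geodesic has the same one since sin d <> 0 when
   0 < d < pi.  Hence x0 = cos d x - sin d u and
   P v = v + <v, u> (sin d x + (cos d - 1) u), and the formulas follow by
   algebra.  The distance never has to be computed as an arc cosine. *)
Require Import Defs.
From HB Require Import structures.
From mathcomp Require Import all_boot all_order all_algebra.
From mathcomp Require Import all_classical all_reals all_analysis.
From mathcomp Require Import measurable_realfun ring lra.
Import Order.TTheory GRing.Theory Num.Theory.
Import numFieldNormedType.Exports.
Set Implicit Arguments.
Unset Strict Implicit.
Unset Printing Implicit Defensive.
Local Open Scope classical_set_scope.
Local Open Scope ring_scope.

(** * Reflection of the unit interval in Lebesgue integrals *)

Section Reflection.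
Context {R : realType}.
Let mu := @lebesgue_measure R.
Local Notation r := (fun t : R => 1 - t).
Import HBNNSimple.

Lemma measurable_onem : measurable_fun [set: R] r.
Proof. exact: measurable_funB. Qed.

(** The pushforward of [mu] by the reflection agrees with [mu] on half-open intervals: the closed
    end moves to the other side but the length is kept. Uniqueness of Lebesgue measure does the
    rest. *)
Lemma lebesgue_measure_onem (A : set R) : measurable A ->
  mu (r @^-1` A) = mu A.
Proof.
move=> mA.
suff : pushforward mu (r : _ -> measurableTypeR R) A = mu A by [].
apply/esym/lebesgue_measure_unique => //=.
  exact: measurable_onem.
move=> ? _ [[a b]] _ <-.
rewrite /pushforward.
have -> : r @^-1` `]a, b] = `[1 - b, 1 - a[%classic.
  by apply/seteqP; split => t /=; rewrite !in_itv/=; lra.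
rewrite !lebesgue_measure_itv/= !lte_fin.
by rewrite ltrD2l ltrN2; case: ifP => // _; congr (_%:E); ring.
Qed.

(* No measurability is assumed on f: reflection preserves the nonnegative
   simple functions below f, and the integral is the supremum of theirs. *)
Lemma integral_onem_le (D : set R) (f : R -> \bar R) :
   (forall x, 0 <= f x)%E -> r @^-1` D = D ->
  (\int[mu]_(t in D) f (1 - t)%R <= \int[mu]_(t in D) f t)%E.
Proof.
move=> f0 rD; rewrite !ge0_integralE//.
apply: ge_ereal_sup => _ [h hf <-].
have mr := measurable_onem.
have mhr : measurable_fun [set: measurableTypeR R] (h \o r) by exact: measurableT_comp.
have fhr : finite_set (range (h \o r)).
  by apply: sub_finite_set (fimfunP h) => _ [t _ <-]; exists (1 - t).
have phr x : 0 <= (h \o r) x by exact: fun_ge0.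
pose hr : {nnsfun (measurableTypeR R) >-> R} := HB.pack (h \o r)
  (isMeasurableFun.Build _ _ (measurableTypeR R) R (h \o r) mhr)
  (FiniteImage.Build (measurableTypeR R) R (h \o r) fhr)
  (isNonNegFun.Build (measurableTypeR R) R (h \o r) phr).
apply: ereal_sup_ubound; exists hr => [t|] /=.
- have := hf (1 - t); rewrite /patch.
  have -> : (1 - t \in D) = (t \in D) by rewrite -[in RHS]rD; apply/idP/idP; rewrite !inE.
  by rewrite subKr.
- apply: eq_fsbigr => z _; congr (_ * _)%E.
  have mz : measurable (h @^-1` [set z]).
    by apply: measurable_funPTI; exact: measurable_set1.
  exact: (lebesgue_measure_onem mz).
Qed.

Lemma Rintegral_onem (f : R -> R) : (forall x, 0 <= f x) ->
  \int[mu]_(t in `[0, 1]) f (1 - t) = \int[mu]_(t in `[0, 1]) f t.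
Proof.
move=> f0; rewrite /Rintegral; congr fine.
have r01 : r @^-1` `[0, 1] = `[0, 1]%classic.
  by apply/seteqP; split => t /=; rewrite !in_itv/=; lra.
apply/eqP; rewrite eq_le; apply/andP; split.
  by apply: (integral_onem_le (f := EFin \o f)) => // x; rewrite lee_fin.
(* The reverse inequality is the first one for the reflected function, reflection being an
   involution. *)
have -> : (\int[mu]_(t in `[0%R, 1%R]) (f t)%:E = \int[mu]_(t in `[0%R, 1%R]) (f (1 - (1 - t))%R)%:E)%E.
  by apply: eq_integral => t _; rewrite subKr.
by apply: (integral_onem_le (f := fun t => (f (1 - t))%:E)) => // x; rewrite lee_fin.
Qed.
End Reflection.

(** * Reversal of curves *)

Section Reversal.
Context {R : realType} {n : nat}.
Local Notation E := 'cV[R]_n.+1.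
Implicit Types (c V : R -> E) (t : R).

Lemma is_derive1_coord c t i : derivable c t 1 ->
  is_derive t 1 (fun t => c t i ord0) (derive1 c t i ord0).
Proof.
move=> dc; rewrite derive1E derive_mx// mxE.
exact/derivableP/(derivable_mxP _ _ _).1.
Qed.

(** The scalar chain rule is applied to each coordinate, and the coordinates are then
    reassembled. *)
Lemma is_derive1_onem c t : derivable c (1 - t) 1 ->
  is_derive t 1 (fun t => c (1 - t)) (- derive1 c (1 - t)).
Proof.
move=> dc; have h i : is_derive t 1 (fun t => c (1 - t) i ord0) (- derive1 c (1 - t) i ord0).
  have ? := is_derive1_coord i dc.
  have d1 : is_derive t 1 (fun t : R => 1 - t) (-1).
    rewrite -[-1]sub0r; exact: (is_deriveB (is_derive_cst (1 : R) t 1) (is_derive_id t 1)).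
  rewrite -mulrN1.
  exact: (is_derive1_comp (f := fun t => c t i ord0) (g := fun t => 1 - t)).
have dr : derivable (fun t => c (1 - t)) t 1.
  by apply/derivable_mxP => i j; rewrite (ord1 j); have [] := h i.
apply: DeriveDef => //.
rewrite derive_mx//; apply/matrixP => i j; rewrite (ord1 j) !mxE.
by have [] := h i.
Qed.

Lemma innerE (u v : E) : inner u v = \sum_i u i ord0 * v i ord0.
Proof. by rewrite /inner mxE; apply: eq_bigr => i _; rewrite mxE. Qed.

Lemma norm2N (v : E) : norm2 (- v) = norm2 v.
Proof.
by rewrite /norm2 !innerE; congr Num.sqrt; apply: eq_bigr => i _; rewrite !mxE mulrNN.
Qed.

(* No hypothesis on c is needed: at a point where c is not differentiable,
   both sides are the norm of the same default value. *)
Lemma norm2_derive1_onem c t :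
  norm2 (derive1 (fun t => c (1 - t)) t) = norm2 (derive1 c (1 - t)).
Proof.
have [dc|ndc] := pselect (derivable c (1 - t) 1).
  by rewrite derive1E; have [_ ->] := is_derive1_onem dc; rewrite norm2N.
rewrite !derive1E /derive dvgP; last first.
  move=> dr; apply: ndc.
  have : derivable (fun t => c (1 - t)) (1 - (1 - t)) 1 by rewrite subKr.
  move/is_derive1_onem => [].
  by rewrite (_ : (fun t => c (1 - (1 - t))) = c)//; apply/funext => s; rewrite subKr.
by rewrite dvgP.
Qed.

Lemma curve_length_onem c : curve_length (fun t => c (1 - t)) = curve_length c.
Proof.
rewrite [RHS]/curve_length -[RHS](Rintegral_onem (f := fun t => norm2 (derive1 c t))); last first.
  by move=> t; exact: sqrtr_ge0.
by rewrite /curve_length; apply: eq_Rintegral => t _; rewrite norm2_derive1_onem.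
Qed.

Lemma C1_on_onem a b c : C1_on a b c -> C1_on (1 - b) (1 - a) (fun t => c (1 - t)).
Proof.
case=> g [dg cg cgE]; exists (fun t => g (1 - t)); split.
- by move=> t; have [] := is_derive1_onem (dg (1 - t)).
- rewrite (_ : derive1 _ = fun t => - derive1 g (1 - t)); last first.
    by apply/funext => t; rewrite derive1E; have [_ ->] := is_derive1_onem (dg (1 - t)).
  move=> t; apply: cvgN; apply: (continuous_comp (f := fun t : R => 1 - t)) => //.
    by apply: continuousB => //; exact: cst_continuous.
  exact: cg.
- by move=> t; rewrite in_itv/= => t01; apply: cgE; rewrite in_itv/=; lra.
Qed.

Lemma piecewise_C1_onem c : piecewise_C1 c -> piecewise_C1 (fun t => c (1 - t)).
Proof.
case=> s [ps ls cs].
(* The reflected break points in increasing order. The head of [p] is 0 because [s] ends at 1, so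
   [behead p] is the required witness; its piece [i] is the reversal of the original piece
   [size s - i.+1]. *)
pose p := map (fun x => 1 - x) (rev (0 :: s)).
have sp : size p = (size s).+1 by rewrite size_map size_rev.
have nthp i : (i <= size s)%N -> nth 0 p i = 1 - nth 0 (0 :: s) (size s - i).
  by move=> si; rewrite (nth_map 0) ?size_rev//= nth_rev//= subSS.
have p0 : nth 0 p 0 = 0.
  by rewrite nthp// subn0 -last_nth ls subrr.
have pE : p = 0 :: behead p by rewrite -[in RHS]p0; case: (p) sp.
have sb : size (behead p) = size s by rewrite size_behead sp.
exists (behead p); split.
- change (sorted <%R (0 :: behead p)); rewrite -pE sorted_map rev_sorted.
  apply: sub_path ps => x y /=; lra.
- by rewrite (last_nth 0) -pE sb nthp// subnn/= subr0.
- move=> i; rewrite sb => si.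
  rewrite -pE nthp ?(ltnW si)// nth_behead nthp//.
  have := @cs (size s - i.+1)%N; rewrite subnSK//.
  move=> /(_ (leq_subr _ _))/C1_on_onem.
  by rewrite -[in nth 0 (0 :: s) (size s - i)](subnSK si).
Qed.

End Reversal.

(** * Symmetry of the geodesic distance *)

Section Geodesics.
Context {R : realType} {n : nat}.
Local Notation E := 'cV[R]_n.+1.
Implicit Types (x y u v w : E) (c V : R -> E) (t : R).

Lemma curves_onem x y c : curves x y c -> curves y x (fun t => c (1 - t)).
Proof.
case=> pc sc c0 c1; split; rewrite ?subr0 ?subrr//.
- exact: piecewise_C1_onem.
- by move=> t t01; apply: sc; move: t01; rewrite !in_itv/=; lra.
Qed.

Lemma geodistC x y : geodist x y = geodist y x.
Proof.
have h (a b : E) : curve_length @` curves a b `<=` curve_length @` curves b a.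
  move=> _ [c cc <-]; exists (fun t => c (1 - t)); first exact: curves_onem.
  exact: curve_length_onem.
by congr inf; apply/seteqP; split; exact: h.
Qed.

(** * Euclidean inner product and differential calculus along curves *)

Lemma innerC u v : inner u v = inner v u.
Proof. by rewrite !innerE; apply: eq_bigr => i _; rewrite mulrC. Qed.

Lemma innerDl u v w : inner (u + v) w = inner u w + inner v w.
Proof. by rewrite !innerE -big_split; apply: eq_bigr => i _; rewrite mxE mulrDl. Qed.

Lemma innerZl a u v : inner (a *: u) v = a * inner u v.
Proof. by rewrite !innerE mulr_sumr; apply: eq_bigr => i _; rewrite mxE mulrA. Qed.

Lemma innerNl u v : inner (- u) v = - inner u v.
Proof. by rewrite -scaleN1r innerZl mulN1r. Qed.

Lemma innerDr u v w : inner u (v + w) = inner u v + inner u w.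
Proof. by rewrite !(innerC u) innerDl. Qed.

Lemma innerZr a u v : inner u (a *: v) = a * inner u v.
Proof. by rewrite !(innerC u) innerZl. Qed.

Lemma innerNr u v : inner u (- v) = - inner u v.
Proof. by rewrite !(innerC u) innerNl. Qed.

Definition inner_bilinear :=
  (innerDl, innerDr, innerZl, innerZr, innerNl, innerNr).

Lemma norm2_sqr v : norm2 v ^+ 2 = inner v v.
Proof.
by rewrite sqr_sqrtr// innerE sumr_ge0// => i _; rewrite -expr2 sqr_ge0.
Qed.

Lemma inner_eq0 v : inner v v = 0 -> v = 0.
Proof.
rewrite innerE => /eqP; rewrite psumr_eq0; last by move=> i _; rewrite -expr2 sqr_ge0.
move=> /allP v0; apply/matrixP => i j; rewrite (ord1 j) mxE.
by have /(_ (mem_index_enum i)) := v0 i; rewrite /= -expr2 sqrf_eq0 => /eqP.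
Qed.

Lemma tprojE x v : tproj x *m v = v - inner x v *: x.
Proof.
rewrite /tproj mulmxBl mul1mx -mulmxA [x^T *m v]mx11_scalar mul_mx_scalar.
by rewrite -/(inner x v).
Qed.

Lemma is_derive_inner c V dc dV t : is_derive t 1 c dc -> is_derive t 1 V dV ->
  is_derive t 1 (fun t => inner (c t) (V t)) (inner dc (V t) + inner (c t) dV).
Proof.
move=> [cd cE] [Vd VE].
have hc i := is_derive1_coord i cd; have hV i := is_derive1_coord i Vd.
have := is_derive_sum (fun i => is_deriveM (hc i) (hV i)).
set f := \sum_i _; have -> : f = fun t => inner (c t) (V t).
  by apply/funext => s; rewrite /f innerE fct_sumE.
rewrite !derive1E cE VE => h; apply: is_derive_eq; rewrite !innerE -big_split.
by apply: eq_bigr => i _; rewrite addrC; congr (_ + _); rewrite [LHS]mulrC.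
Qed.

Lemma is_derive1E c t : derivable c t 1 -> is_derive t 1 c (derive1 c t).
Proof. by move=> dc; rewrite derive1E; exact/derivableP. Qed.

Lemma is_derive_cst_eq0 (f : R -> R) k df t :
  (forall s, f s = k) -> is_derive t 1 f df -> df = 0.
Proof. by move=> /funext -> [_ <-]; rewrite derive_cst. Qed.

Lemma is_derive0_cstmx c : (forall t, is_derive t 1 c 0) -> forall t, c t = c 0.
Proof.
move=> dc t; apply/matrixP => i j; rewrite (ord1 j).
apply: (is_derive_0_is_cst (f := fun t => c t i ord0)) => {}t.
have [cd cE] := dc t; have := is_derive1_coord i cd.
by rewrite derive1E cE mxE.
Qed.

(** Rotating the pair (w f, g) back by the angle w t gives two constant quantities, [A] and [B]
    below; the relation cos^2 + sin^2 = 1 inverts the rotation. Keeping the factor w on f avoids a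
    division, so w = 0 is covered. *)
Lemma harmonic_oscillator (f g : R -> R) (w : R) :
  (forall t, is_derive t 1 f (g t)) ->
  (forall t, is_derive t 1 g (- (w ^+ 2) * f t)) -> forall t,
  w * f t = w * cos (w * t) * f 0 + sin (w * t) * g 0 /\
  g t = cos (w * t) * g 0 - w * sin (w * t) * f 0.
Proof.
move=> df dg t.
have dw (s : R) : is_derive s 1 (fun s => w * s) w.
  by rewrite -[X in is_derive _ _ _ X]mulr1; exact: (is_deriveZ w (is_derive_id s 1)).
have dcos (s : R) : is_derive s 1 (fun s => cos (w * s)) (- sin (w * s) * w).
  exact: (is_derive1_comp (f := cos) (g := fun s => w * s)).
have dsin (s : R) : is_derive s 1 (fun s => sin (w * s)) (cos (w * s) * w).
  exact: (is_derive1_comp (f := sin) (g := fun s => w * s)).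
have A : w * cos (w * t) * f t - sin (w * t) * g t = w * f 0.
  have := @is_derive_0_is_cst _ (fun t => w * (cos (w * t) * f t) - sin (w * t) * g t) t 0.
  rewrite mulr0 cos0 sin0 mul1r mul0r subr0 mulrA; apply => s.
  apply: (is_derive_eq (is_deriveB (is_deriveZ w (is_deriveM (dcos s) (df s)))
    (is_deriveM (dsin s) (dg s)))).
  rewrite /GRing.scale/=; ring.
have B : w * sin (w * t) * f t + cos (w * t) * g t = g 0.
  have := @is_derive_0_is_cst _ (fun t => w * (sin (w * t) * f t) + cos (w * t) * g t) t 0.
  rewrite mulr0 cos0 sin0 mul1r mul0r mulr0 add0r mulrA; apply => s.
  apply: (is_derive_eq (is_deriveD (is_deriveZ w (is_deriveM (dsin s) (df s)))
    (is_deriveM (dcos s) (dg s)))).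
  rewrite /GRing.scale/=; ring.
have cs := cos2Dsin2 (w * t).
split.
  rewrite -[LHS]mul1r -cs -B (_ : w * cos (w * t) * f 0 = cos (w * t) * (w * f 0)); last by ring.
  by rewrite -A; ring.
rewrite -[LHS]mul1r -cs -B (_ : w * sin (w * t) * f 0 = sin (w * t) * (w * f 0)); last by ring.
by rewrite -A; ring.
Qed.

(** Two sign changes cancel in the second derivative, so the covariant acceleration is just
    reparametrized. *)
Lemma geodesic_onem c : geodesic c -> geodesic (fun t => c (1 - t)).
Proof.
case=> sc dc d2c cc.
have d1E : derive1 (fun t => c (1 - t)) = fun t => - derive1 c (1 - t).
  by apply/funext => t; rewrite derive1E; have [_ ->] := is_derive1_onem (dc (1 - t)).
have d2 (t : R) : is_derive t 1 (fun t => - derive1 c (1 - t)) (derive1 (derive1 c) (1 - t)).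
  by rewrite -[X in is_derive _ _ _ X]opprK; exact/is_deriveN/is_derive1_onem.
split=> t.
- exact: sc.
- by have [] := is_derive1_onem (dc (1 - t)).
- by rewrite d1E; have [] := d2 t.
- by rewrite /covD d1E derive1E; have [_ ->] := d2 t; exact: cc.
Qed.

(** * Great circles and parallel fields along them *)

Section Geodesic.
Variables (c : R -> E) (gc : geodesic c).
Let w := norm2 (derive1 c 0).

Lemma geodesic_sphere t : inner (c t) (c t) = 1.
Proof. by case: gc => /(_ t) /= sc _ _ _; rewrite -norm2_sqr sc expr1n. Qed.

Let dc t : is_derive t 1 c (derive1 c t).
Proof. by case: gc => _ ? _ _; exact: is_derive1E. Qed.

Let d2c t : is_derive t 1 (derive1 c) (derive1 (derive1 c) t).
Proof. by case: gc => _ _ ? _; exact: is_derive1E. Qed.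

Lemma geodesic_orth t : inner (c t) (derive1 c t) = 0.
Proof.
have := is_derive_cst_eq0 geodesic_sphere (is_derive_inner (dc t) (dc t)).
by rewrite innerC; lra.
Qed.

(** Zero covariant acceleration means c'' = <c, c''> c, and differentiating <c, c'> = 0 gives <c,
    c''> = - <c', c'>. *)
Lemma geodesic_acc t :
  derive1 (derive1 c) t = - inner (derive1 c t) (derive1 c t) *: c t.
Proof.
have h := is_derive_cst_eq0 geodesic_orth (is_derive_inner (dc t) (d2c t)).
case: gc => _ _ _ /(_ t); rewrite /covD tprojE => /subr0_eq {1}->.
by congr (_ *: _); apply/eqP; rewrite -addr_eq0 addrC h.
Qed.

(** The derivative of <c', c'> is 2 <c'', c'>, which vanishes because c'' is a multiple of c and c
    is orthogonal to c'. *)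
Lemma geodesic_speed t : norm2 (derive1 c t) = w.
Proof.
have h : inner (derive1 c t) (derive1 c t) = inner (derive1 c 0) (derive1 c 0); last first.
  by rewrite /w /norm2 h.
apply: (is_derive_0_is_cst (f := fun t => inner (derive1 c t) (derive1 c t))) => s.
apply: is_derive_eq (is_derive_inner (d2c s) (d2c s)) _.
have o := geodesic_orth s; rewrite innerC in o.
by rewrite geodesic_acc !inner_bilinear o geodesic_orth !mulr0 addr0.
Qed.

Lemma geodesic_accE t : derive1 (derive1 c) t = - w ^+ 2 *: c t.
Proof. by rewrite geodesic_acc -norm2_sqr geodesic_speed. Qed.

Lemma geodesic_length : curve_length c = w.
Proof.
rewrite /curve_length (@eq_Rintegral _ _ _ _ _ (cst w)); last first.
  by move=> t _; exact: geodesic_speed.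
rewrite Rintegral_cst//.
change (w * fine (@lebesgue_measure R `[0, 1]%classic) = w).
by rewrite lebesgue_measure_itv/= lte01 oppr0 adde0 mulr1.
Qed.

Lemma geodesicE t :
  w *: c t = (w * cos (w * t)) *: c 0 + sin (w * t) *: derive1 c 0 /\
  derive1 c t = cos (w * t) *: derive1 c 0 - (w * sin (w * t)) *: c 0.
Proof.
have h i := @harmonic_oscillator (fun t => c t i ord0) (fun t => derive1 c t i ord0) w.
have {}h i : w * c t i ord0 = w * cos (w * t) * c 0 i ord0 + sin (w * t) * derive1 c 0 i ord0 /\
  derive1 c t i ord0 = cos (w * t) * derive1 c 0 i ord0 - w * sin (w * t) * c 0 i ord0.
  apply: h => s.
  - by have [? _] := dc s; exact: is_derive1_coord.
  - have [d _] := d2c s; have := is_derive1_coord i d.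
    by rewrite geodesic_accE mxE.
by split; apply/matrixP => i j; rewrite (ord1 j) !mxE; have [] := h i.
Qed.

Lemma geodesic_cst : w = 0 -> forall t, c t = c 0.
Proof.
move=> w0; apply: is_derive0_cstmx => t.
have -> : 0 = derive1 c t; last exact: dc.
by apply/esym/inner_eq0; rewrite -norm2_sqr geodesic_speed w0 expr0n.
Qed.

(* Both <V, c'> and w^2 V - <V, c'> c' are constant along c. *)
Lemma parallel_geodesicE V t : parallel c V ->
  V t = V 0 + (inner (V 0) (derive1 c 0) / w ^+ 2) *: (derive1 c t - derive1 c 0).
Proof.
case=> tV dV cV.
have {}dV (s : R) : is_derive s 1 V (derive1 V s) by exact: is_derive1E.
have VE s : derive1 V s = - inner (V s) (derive1 c s) *: c s.
  have h := is_derive_cst_eq0 tV (is_derive_inner (dc s) (dV s)).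
  have := cV s; rewrite /covD tprojE => /subr0_eq {1}->.
  by congr (_ *: _); apply/eqP; rewrite -addr_eq0 addrC innerC h.
pose k := inner (V 0) (derive1 c 0).
have kE s : inner (V s) (derive1 c s) = k.
  apply: (is_derive_0_is_cst (f := fun t => inner (V t) (derive1 c t))) => {}s.
  apply: is_derive_eq (is_derive_inner (dV s) (d2c s)) _.
  rewrite geodesic_accE VE !inner_bilinear geodesic_orth [inner (V s) (c s)]innerC.
  by rewrite tV !mulr0 addr0.
(* For w = 0 the quotient by w^2 is 0 by convention, so the claim is that V is constant; this holds
   since c' = 0 forces k = 0. *)
have [w0|w0] := eqVneq w 0.
  rewrite w0 expr0n invr0 mulr0 scale0r addr0; apply: is_derive0_cstmx => s.
  have -> : 0 = derive1 V s; last exact: dV.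
  have -> : derive1 V s = - k *: c s by rewrite VE kE.
  have -> : k = 0; last by rewrite oppr0 scale0r.
  rewrite /k (_ : derive1 c 0 = 0) ?innerE ?big1// => [i _|]; first by rewrite mxE mulr0.
  by apply: inner_eq0; rewrite -norm2_sqr -/w w0 expr0n.
have h : (fun t => V t - (k / w ^+ 2) *: derive1 c t) t = V 0 - (k / w ^+ 2) *: derive1 c 0.
  apply: (is_derive0_cstmx (c := fun t => V t - (k / w ^+ 2) *: derive1 c t)) => s.
  apply: is_derive_eq (is_deriveB (dV s) (is_deriveZ (k / w ^+ 2) (d2c s))) _.
  rewrite VE kE geodesic_accE scalerA -scalerBl (_ : _ - _ = 0) ?scale0r//.
  by field.
by rewrite scalerBr addrCA -h/= addrC subrK.
Qed.

(** The closed form forced on parallel fields is taken as the definition of V. Its derivative is a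
    multiple of c, which the tangential projection kills. *)
Lemma parallel_geodesic_ex v : tangent (c 0) v -> exists2 V, parallel c V & V 0 = v.
Proof.
move=> tv.
pose k := inner v (derive1 c 0).
pose V := fun t => v + (k / w ^+ 2) *: (derive1 c t - derive1 c 0).
have dV (s : R) : is_derive s 1 V ((k / w ^+ 2) *: (- w ^+ 2 *: c s)).
  apply: is_derive_eq (is_deriveD (is_derive_cst v s 1)
    (is_deriveZ (k / w ^+ 2) (is_deriveB (d2c s) (is_derive_cst (derive1 c 0) s 1)))) _.
  by rewrite add0r subr0 geodesic_accE.
exists V; last by rewrite /V subrr scaler0 addr0.
split=> [t|t|t].
- rewrite /tangent/= /V !inner_bilinear geodesic_orth sub0r.
  have [w0|w0] := eqVneq w 0.
    by rewrite w0 expr0n invr0 mulr0 mul0r addr0 geodesic_cst.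
  (* Tangency is checked after multiplication by w, since the great circle formula describes w c
     rather than c. *)
  have cv : w * inner (c t) v = sin (w * t) * k.
    by rewrite -innerZl (geodesicE t).1 !inner_bilinear tv mulr0 add0r innerC.
  have cp : w * inner (c t) (derive1 c 0) = sin (w * t) * w ^+ 2.
    by rewrite -innerZl (geodesicE t).1 !inner_bilinear geodesic_orth mulr0 add0r norm2_sqr.
  apply: (mulfI w0); rewrite mulr0 mulrDr cv mulrN mulrN mulrCA cp; field.
  exact: w0.
- by have [] := dV t.
- rewrite /covD derive1E; have [_ ->] := dV t.
  by rewrite tprojE !inner_bilinear geodesic_sphere mulr1 !scalerA subrr.
Qed.

End Geodesic.

Lemma min_geodesic_onem x y c :
  min_geodesic x y c -> min_geodesic y x (fun t => c (1 - t)).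
Proof.
case=> gc c0 c1 lc; split.
- exact: geodesic_onem.
- by rewrite subr0.
- by rewrite subrr.
- by rewrite curve_length_onem lc geodistC.
Qed.

(** * Minimizing geodesics and transport along them *)

Lemma min_geodesic_velocity x y c : min_geodesic x y c ->
  norm2 (derive1 c 0) = geodist x y.
Proof. by case=> gc _ _ <-; rewrite geodesic_length. Qed.

Lemma min_geodesicE x y c (d := geodist x y) : min_geodesic x y c ->
  d *: y = (d * cos d) *: x + sin d *: derive1 c 0 /\
  derive1 c 1 = cos d *: derive1 c 0 - (d * sin d) *: x.
Proof.
move=> mc; have [gc c0 c1 _] := mc.
by have := geodesicE gc 1; rewrite (min_geodesic_velocity mc) mulr1 c0 c1.
Qed.

(** The formula for the endpoint y determines sin d c'(0), and sin d > 0 if 0 < d < pi. If d = 0,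
    both velocities vanish. *)
Lemma min_geodesic_uniq x y c1 c2 : geodist x y < pi ->
  min_geodesic x y c1 -> min_geodesic x y c2 -> derive1 c1 0 = derive1 c2 0.
Proof.
move=> dpi m1 m2; have w1 := min_geodesic_velocity m1; have w2 := min_geodesic_velocity m2.
have [d0|d0] := eqVneq (geodist x y) 0.
  have z c : norm2 (derive1 c 0) = geodist x y -> derive1 c 0 = 0.
    by move=> h; apply: inner_eq0; rewrite -norm2_sqr h d0 expr0n.
  by rewrite (z _ w1) (z _ w2).
have dgt0 : 0 < geodist x y by rewrite lt_def d0/= -w1 sqrtr_ge0.
have [e1 _] := min_geodesicE m1; have [e2 _] := min_geodesicE m2.
move: e1; rewrite e2 => /addrI/esym.
by apply: scalerI; rewrite gt_eqF// sin_gt0_pi// dgt0.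
Qed.

Lemma transportE x y c v : geodist x y < pi -> min_geodesic x y c -> tangent x v ->
  transport x y v =
  v + (inner v (derive1 c 0) / geodist x y ^+ 2) *: (derive1 c 1 - derive1 c 0).
Proof.
move=> dpi mc tv; have [gc c0 c1 lc] := mc.
have wE := min_geodesic_velocity mc.
(* The explicit parallel field provides a value; any other admissible pair gives the same one,
   because its geodesic has the same initial velocity. *)
apply: xget_unique.
  rewrite -c0 in tv; have [V pV V0] := parallel_geodesic_ex gc tv.
  by exists c, V; split=> //; rewrite (parallel_geodesicE gc _ pV) V0 wE.
move=> z [c' [V [mc' pV V0 <-]]].
have [gc' _ _ _] := mc'.
rewrite (parallel_geodesicE gc' _ pV) V0 (min_geodesicE mc').2 (min_geodesicE mc).2.
by rewrite (min_geodesic_velocity mc') (min_geodesic_uniq dpi mc' mc).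
Qed.

Lemma transport_radial x0 x u : geodist x x0 < pi -> radial x0 x u ->
  let d := geodist x x0 in
  x0 = cos d *: x - sin d *: u /\
  forall v, tangent x v ->
    transport x x0 v = v + inner v u *: (sin d *: x + (cos d - 1) *: u).
Proof.
move=> dpi [tu nu [c0 mc0 uE]] d.
have mc := min_geodesic_onem mc0; have [gc c00 c01 _] := mc.
set c := (fun t => _) in mc gc c00 c01.
(* The minus sign comes from the reversal; the factor d is the constant speed of [c0], which is
   [geodist x0 x], hence d by symmetry. *)
have cE : derive1 c 0 = - d *: u.
  have [gc0 _ _ lc0] := mc0; have [_ dc0 _ _] := gc0.
  rewrite derive1E; have [_ ->] := is_derive1_onem (dc0 (1 - 0)).
  rewrite subr0 uE (geodesic_speed gc0) -(geodesic_length gc0) lc0 geodistC.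
  exact/esym/scaleNr.
have wE := min_geodesic_velocity mc; rewrite -/d in wE.
have [c1E dc1E] := min_geodesicE mc; rewrite -/d cE in c1E dc1E.
split=> [|v tv].
  (* If d = 0 the geodesic is constant and x0 = x; otherwise d is cancelled from the endpoint
     formula. *)
  have [d0|d0] := eqVneq d 0.
    rewrite d0 cos0 sin0 scale1r scale0r subr0 -c00 -c01.
    by apply: (geodesic_cst gc); rewrite wE.
  apply: (scalerI d0); rewrite c1E scalerBr !scalerA; congr (_ + _).
  by rewrite mulrN scaleNr mulrC.
rewrite (transportE dpi mc tv) -/d dc1E cE innerZr.
have [d0|d0] := eqVneq d 0.
  by rewrite d0 cos0 sin0; apply/matrixP => i j; rewrite !mxE; ring.
apply/matrixP => i j; rewrite !mxE; field.
exact: d0.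
Qed.

End Geodesics.

(** * Comparison of central projection with parallel transport *)

Theorem lemma2 (R : realType) (n : nat) (hn : (1 <= n)%N)
    (x0 x u : 'cV[R]_n.+1) (hx0 : sphere n x0) (hx : sphere n x)
    (hd : geodist x x0 < pi) (hu : radial x0 x u)
    (v : 'cV[R]_n.+1) (hv : tangent x v) :
  [/\ tproj x0 *m v = transport x x0 v
        - ((1 - cos (geodist x x0)) * inner v u) *: transport x x0 u,
      tproj x0 *m v = transport x x0
        ((v - inner v u *: u) + cos (geodist x x0) *: (inner v u *: u))
    & inner v u = 0 -> tproj x0 *m v = transport x x0 v].
Proof.
have [x0E PE] := transport_radial hd hu.
have [tu nu _] := hu.
set d := geodist x x0 in hd x0E PE *.
have uu : inner u u = 1 by rewrite -norm2_sqr nu expr1n.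
(* The closed form of transport applies to tangent vectors only. *)
have tvu : tangent x ((v - inner v u *: u) + cos d *: (inner v u *: u)).
  by rewrite /tangent/= !inner_bilinear hv tu !mulr0 subrr addr0.
(* Since v is orthogonal to x, only the radial part of x0 contributes: <x0, v> = - sin d <v, u>. The
   projection is thus written in terms of v, x and u, like the transport formula [PE]. *)
have projE : tproj x0 *m v =
    v + inner v u *: ((cos d * sin d) *: x - (1 - cos d ^+ 2) *: u).
  rewrite tprojE -sin2cos2 {2}x0E (_ : inner x0 v = - (inner v u * sin d)); last first.
    by rewrite x0E !inner_bilinear hv (innerC u); ring.
  by apply/matrixP => i j; rewrite !mxE; ring.
have contractE : tproj x0 *m v = transport x x0 v
    - ((1 - cos d) * inner v u) *: transport x x0 u.
  by rewrite projE !PE// uu; apply/matrixP => i j; rewrite !mxE; ring.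
split=> //; last by move=> vu0; rewrite contractE vu0 mulr0 scale0r subr0.
rewrite projE PE// !inner_bilinear uu.
by apply/matrixP => i j; rewrite !mxE; ring.
Qed.
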